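(* For each nonnegative integer $k$, the map $\mathrm{DL}_k$ sends $\mathcal U_{2k+1}(312)$ into $\mathrm{Int}(\mathcal L_k^S)$, and $\mathrm{DL}_k:\mathcal U_{2k+1}(312)\to\mathrm{Int}(\mathcal L_k^S)$ is a bijection.
   Context: Permutations are finite words of distinct positive integers; $S_n$ is the set of permutations of $[n]=\{1,\dots,n\}$. The stack-sorting map $s$ is defined recursively: $s$ of the empty word is empty, and if $\pi=LnR$ where $n$ is the largest entry of $\pi$, then $s(\pi)=s(L)s(R)n$. The fertility of $\pi$ is the number of permutations $\sigma$ (of the same entries) with $s(\sigma)=\pi$; $\pi$ is sorted if its fertility is positive and uniquely sorted if its fertility equals $1$. A permutation $\sigma$ contains a pattern $\tau=\tau_1\cdots\tau_m$ if some subsequence of $\sigma$ has the same relative order as $\tau$; otherwise it avoids $\tau$. $\mathcal U_n(\tau^{(1)},\dots,\tau^{(r)})$ denotes the set of uniquely sorted permutations in $S_n$ avoiding all of $\tau^{(1)},\dots,\tau^{(r)}$. A descent of $\pi=\pi_1\cdots\pi_n$ is an index $i\in[n-1]$ with $\pi_i>\pi_{i+1}$; $\mathrm{Des}(\pi)$ is the set of descents. For $\pi\in S_n$, $\mathrm{rot}(\pi)=\mathrm{rev}(\pi^{-1})$, where $\mathrm{rev}$ reverses the word and $\pi^{-1}$ is the group inverse. A Dyck path of semilength $k$ is a word in $\{U,D\}$ with $k$ letters of each kind such that every prefix has at least as many $U$'s as $D$'s; $\mathbf D_k$ is the set of these. The Stanley lattice $\mathcal L_k^S$ is $\mathbf D_k$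 ordered by $\Lambda\le_S\Lambda'$ iff for every $i\in\{1,\dots,2k\}$ the number of $U$'s among the first $i$ letters of $\Lambda$ is at most that among the first $i$ letters of $\Lambda'$. For a poset $P$, $\mathrm{Int}(P)$ is the set of pairs $(x,y)$ of elements of $P$ with $x\le y$. For $\pi\in\mathcal U_{2k+1}(312)$ with $n=2k+1$, define words $\Lambda=\Lambda_1\cdots\Lambda_{2k}$ and $\Lambda'=\Lambda'_1\cdots\Lambda'_{2k}$ by $\Lambda_i=D$ if $n-i\in\mathrm{Des}(\pi)$ and $\Lambda_i=U$ otherwise, and $\Lambda'_i=U$ if $i\in\mathrm{Des}(\mathrm{rot}(\pi))$ and $\Lambda'_i=D$ otherwise. Set $\mathrm{DL}_k(\pi)=(\Lambda,\Lambda')$. *)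

(* Defs.v *)
From mathcomp Require Import all_boot.

Set Implicit Arguments.
Unset Strict Implicit.
Unset Printing Implicit Defensive.

Definition is_perm_word (n : nat) (p : seq nat) : bool := perm_eq p (iota 1 n).

(* Letters are numbered from 1; the value is 0 outside of 1 .. size p. *)
Definition letter (p : seq nat) (i : nat) : nat := nth 0 p i.-1.

(* The first argument bounds the recursion depth; size w is always enough, see
   [stack_sort_cat] for the recursive characterization. *)
Fixpoint stack_sort_rec (fuel : nat) (w : seq nat) : seq nat :=
  if fuel is fuel'.+1 then
    if w is [::] then [::] else
    let n := \max_(x <- w) x in
    let i := index n w in
    stack_sort_rec fuel' (take i w) ++ stack_sort_rec fuel' (drop i.+1 w)
      ++ [:: n]
  else [::].

Definition stack_sort (w : seq nat) : seq nat := stack_sort_rec (size w) w.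

Definition fertility (p : seq nat) : nat :=
  count (fun q => stack_sort q == p) (permutations p).

Definition uniquely_sorted (p : seq nat) : bool := fertility p == 1.

Definition same_order (u t : seq nat) : bool :=
  (size u == size t) &&
  [forall i : 'I_(size t), forall j : 'I_(size t),
     (nth 0 u i < nth 0 u j) == (nth 0 t i < nth 0 t j)].

Definition contains (p t : seq nat) : bool :=
  [exists m : (size p).-tuple bool, same_order (mask m p) t].

Definition avoids (p t : seq nat) : bool := ~~ contains p t.

Definition US (n : nat) (ts : seq (seq nat)) : pred (seq nat) :=
  [pred p | [&& is_perm_word n p, uniquely_sorted p & all (avoids p) ts]].

Definition Des (p : seq nat) : pred nat :=
  [pred i | (0 < i < size p) && (letter p i > letter p i.+1)].

(* Meaningful when p is a permutation of 1 .. size p: the i-th letter of the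
   inverse is the position, counted from 1, of the letter i in p. *)
Definition inv_word (p : seq nat) : seq nat :=
  [seq (index i p).+1 | i <- iota 1 (size p)].

Definition rot_word (p : seq nat) : seq nat := rev (inv_word p).

(* Words in {U, D} are boolean sequences. *)
Definition U : bool := true.
Definition D : bool := false.

Definition dyck (k : nat) : pred (seq bool) :=
  [pred w | [&& count_mem U w == k, count_mem D w == k &
     all (fun i => count_mem D (take i w) <= count_mem U (take i w))
         (iota 0 (size w).+1)]].

Definition stanley_le (k : nat) : rel (seq bool) :=
  fun w w' => all (fun i => count_mem U (take i w) <= count_mem U (take i w'))
                  (iota 1 k.*2).

(* Int(P), for the poset P given by its carrier and its order relation. *)
Definition intervals (T : Type) (carrier : pred T) (le : rel T) : pred (T * T) :=
  [pred xy | [&& carrier xy.1, carrier xy.2 & le xy.1 xy.2]].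

Definition stanley_intervals (k : nat) : pred (seq bool * seq bool) :=
  intervals (dyck k) (stanley_le k).

Definition DL (k : nat) (p : seq nat) : seq bool * seq bool :=
  let n := k.*2.+1 in
  ([seq if n - i \in Des p then D else U | i <- iota 1 k.*2],
   [seq if i \in Des (rot_word p) then U else D | i <- iota 1 k.*2]).

Lemma stack_sort_recS f w (n := \max_(x <- w) x) : w != [::] ->
  stack_sort_rec f.+1 w =
    stack_sort_rec f (take (index n w) w)
      ++ stack_sort_rec f (drop (index n w).+1 w) ++ [:: n].
Proof. by rewrite {}/n; case: w. Qed.

Lemma mem_bigmax w : w != [::] -> \max_(x <- w) x \in w.
Proof.
case: w => // a w _; elim: w a => [|b w IHw] a; first by rewrite big_seq1 inE.
rewrite big_cons /maxn; case: ifP => _; last exact: mem_head.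
by rewrite inE IHw orbT.
Qed.

Lemma stack_sort_rec_fuel f g w :
  size w <= f -> size w <= g -> stack_sort_rec f w = stack_sort_rec g w.
Proof.
elim: f g w => [|f IHf] [|g] w lef leg;
  have [->//|nz_w] := eqVneq w [::];
  try by move: lef leg; rewrite !leqn0 !size_eq0 (negPf nz_w).
rewrite !stack_sort_recS //; set i := index _ _.
have lt_i : i < size w by rewrite index_mem mem_bigmax.
have le1 h : size w <= h.+1 -> size (take i w) <= h.
  by move=> leh; rewrite size_takel ?(ltnW lt_i) // -ltnS (leq_trans lt_i leh).
have le2 h : size w <= h.+1 -> size (drop i.+1 w) <= h.
  by move=> leh; rewrite size_drop leq_subLR (leq_trans leh) // addSn ltnS leq_addl.
by congr (_ ++ (_ ++ _)); apply: IHf; auto.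
Qed.

Lemma stack_sort_cat L n R : all (ltn^~ n) (L ++ R) ->
  stack_sort (L ++ n :: R) = stack_sort L ++ stack_sort R ++ [:: n].
Proof.
move=> lt_n.
have maxE : \max_(x <- L ++ n :: R) x = n.
  apply/eqP; rewrite eqn_leq; apply/andP; split.
    apply/bigmax_leqP_seq => x; rewrite mem_cat inE orbCA => /predU1P[-> //|xLR] _.
    by apply: ltnW; apply: (allP lt_n); rewrite mem_cat.
  by apply: (@leq_bigmax_seq _ _ xpredT id) => //; rewrite mem_cat mem_head orbT.
have nL : n \notin L.
  apply/negP => nL; have := allP lt_n n; rewrite mem_cat nL /= ltnn.
  by move/(_ isT).
have idxE : index n (L ++ n :: R) = size L.
  by rewrite index_cat (negPf nL) /= eqxx addn0.
rewrite /stack_sort; case def_w: (size (L ++ n :: R)) => [|m].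
  by move: def_w; rewrite size_cat /= addnS.
rewrite stack_sort_recS; last by rewrite -size_eq0 def_w.
rewrite maxE idxE take_size_cat // drop_cat ltnNge leqnSn subSnn /= drop0.
move: def_w; rewrite size_cat /= addnS => -[def_m].
by congr (_ ++ (_ ++ _)); apply: stack_sort_rec_fuel;
   rewrite // -def_m ?leq_addr ?leq_addl.
Qed.

Lemma containsP p t :
  reflect (exists2 u, subseq u p & same_order u t) (contains p t).
Proof.
apply: (iffP existsP) => [[m mt]|[u /subseqP[m szm ->] mt]].
  by exists (mask m p) => //; apply: mask_subseq.
by exists (Tuple (introT eqP szm)).
Qed.

(* Main.v *)
Require Import Defs.
From mathcomp Require Import all_boot zify.

(** Since [s(L n R) = s(L) s(R) n], induction on the preimage shows that every
suffix of a sorted word has at least as many ascents as descents ([ballot]), and that a sorted word is uniquely sorted exactly when it has as many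
descents as ascents.  For a 312-avoiding word the suffix condition is also
sufficient for being sorted: one cuts at the shortest suffix in which, once the
final maximum is removed, descents outnumber ascents.  Reading the descent word
backwards, [p] is therefore uniquely sorted iff the first path of [DL] is a Dyck
path.

It remains to see that the descent words [(d, e)] of [p] and of its inverse
identify 312-avoiding permutations with pairs of words such that [e] dominates
[d] and both have the same number of descents.  If [p = v p'], then [v] is the
first non-descent of the inverse, and standardizing [p'] removes the first letter
[b] of [d] and the first occurrence of [b] in [e]; this recursion can be run
backwards. *)

Set Implicit Arguments.
Unset Strict Implicit.
Unset Printing Implicit Defensive.

(** In a descent word [true] marks a descent and [false] an ascent, so [nT] counts descents and [nF]
    counts ascents. *)
Notation nT := (@count bool (fun b => b)).
Notation nF := (@count bool negb).

(** * Stack-sorting on decreasing binary trees *)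

Lemma uniq_node (T : eqType) (L R : seq T) (n : T) : uniq (L ++ n :: R) ->
  [/\ uniq L, uniq R, n \notin L ++ R & uniq (L ++ R)].
Proof.
rewrite -cat1s uniq_catCA /= => /andP[nLR uLR]; split=> //.
  by move: uLR; rewrite cat_uniq => /and3P[].
by move: uLR; rewrite cat_uniq => /and3P[].
Qed.

(* Induction on the decreasing binary tree of a word. *)
Lemma uniq_max_ind (P : seq nat -> Prop) :
    P [::] ->
    (forall (L : seq nat) (n : nat) (R : seq nat), uniq (L ++ n :: R) -> all (ltn^~ n) (L ++ R) ->
      P L -> P R -> P (L ++ n :: R)) ->
  forall q : seq nat, uniq q -> P q.
Proof.
move=> P0 PS q; have [m] := ubnP (size q).
elim: m q => // m IHm q leqm uq.
have [->//|q0] := eqVneq q [::].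
have [n nq maxE] : exists2 n, n \in q & forall x, x \in q -> x <= n.
  exists (\max_(x <- q) x); first exact: mem_bigmax.
  by move=> x xq; apply: (@leq_bigmax_seq _ _ xpredT id).
have [L [R defq]] : exists L R : seq nat, q = L ++ n :: R.
  by case/splitPr: nq => L R; exists L, R.
rewrite {q q0 nq}defq in leqm uq maxE *.
have [uL uR nLR _] := uniq_node uq.
move: leqm; rewrite size_cat /= => leqm.
apply: PS => //; [|by apply: IHm => //; lia|by apply: IHm => //; lia].
apply/allP => x xLR /=; rewrite ltn_neqAle maxE ?andbT.
  by apply: contraNneq nLR => <-.
by move: xLR; rewrite !mem_cat inE orbCA => ->; rewrite orbT.
Qed.

(** Letters may repeat here, so [stack_sort_cat] does not apply; the recursion is unfolded at the
    first occurrence of the maximum, with the fuel generalized to any bound on the size. *)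
Lemma perm_stack_sort q : perm_eq (stack_sort q) q.
Proof.
rewrite /stack_sort; move: (leqnn (size q)); move: {2 3}(size q) => m.
elim: m q => [|m IHm] q; first by rewrite leqn0 size_eq0 => /eqP->.
have [->//|q0] := eqVneq q [::]; move=> leqm.
rewrite stack_sort_recS //; have nq := mem_bigmax q0.
set n := \max_(x <- q) x in nq *; set i := index n q.
have lti : i < size q by rewrite index_mem.
have := cat_take_drop i q; rewrite (drop_nth 0) // nth_index // => defq.
rewrite -[X in perm_eq _ X]defq perm_cat //.
  by rewrite IHm // size_takel ?(ltnW lti) // -ltnS (leq_trans lti).
by rewrite cats1 perm_rcons perm_cons IHm // size_drop; lia.
Qed.

Lemma stack_sort_size q : size (stack_sort q) = size q.
Proof. exact/perm_size/perm_stack_sort. Qed.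

Lemma stack_sort_eq0 q : (stack_sort q == [::]) = (q == [::]).
Proof. by rewrite -!size_eq0 stack_sort_size. Qed.

Lemma mem_stack_sort q : stack_sort q =i q.
Proof. exact/perm_mem/perm_stack_sort. Qed.

Lemma stack_sort_uniq q : uniq (stack_sort q) = uniq q.
Proof. exact/perm_uniq/perm_stack_sort. Qed.

Lemma stack_sort_le_last q : uniq q ->
  forall x, x \in q -> x <= last 0 (stack_sort q).
Proof.
move: q; apply: uniq_max_ind => // L n R uq ltx _ _ x.
rewrite stack_sort_cat // catA last_cat /= mem_cat inE orbCA => /predU1P[-> //|].
by rewrite -mem_cat => xLR; apply/ltnW/(allP ltx).
Qed.

(** Every preimage of [p] is a rearrangement of [p], and [permutations p] lists each of these once,
    so the count sees all preimages. *)
Lemma uniquely_sortedP p :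
  reflect (exists2 q, stack_sort q = p & forall q', stack_sort q' = p -> q' = q)
          (uniquely_sorted p).
Proof.
rewrite /uniquely_sorted /fertility -size_filter.
have memP q : (q \in [seq q <- permutations p | stack_sort q == p])
            = (stack_sort q == p).
  rewrite mem_filter mem_permutations; case: eqP => //= <-.
  by rewrite perm_sym perm_stack_sort.
apply: (iffP eqP) => [|[q sq sq']].
  case E: [seq _ <- _ | _] memP => [//|q [|//]] memP _.
  exists q; first by apply/eqP; rewrite -memP mem_head.
  by move=> q' /eqP; rewrite -memP inE => /eqP.
rewrite (@perm_size _ _ [:: q]) //; apply: uniq_perm => //.
  exact/filter_uniq/permutations_uniq.
by move=> q'; rewrite memP inE; apply/eqP/eqP => [/sq'|->].
Qed.

(** * Descent words and the ballot condition *)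

Definition des (p : seq nat) : seq bool :=
  if p is x :: q then pairmap (fun a b => b < a) x q else [::].

Lemma size_des p : size (des p) = (size p).-1.
Proof. by case: p => //= x q; rewrite size_pairmap. Qed.

Lemma des_cat A B : A != [::] -> B != [::] ->
  des (A ++ B) = des A ++ (head 0 B < last 0 A) :: des B.
Proof. by case: A B => [|a A] [|b B] //= _ _; rewrite pairmap_cat. Qed.

Lemma des_split p x c y : des p = x ++ c :: y ->
  exists A B, [/\ p = A ++ B, A != [::], B != [::], des A = x & des B = y].
Proof.
case: p => [|a p]; first by case: x.
elim: p a x => [|b p IHp] a [|d x] //= [defd].
  by move=> <-; exists [:: a], (b :: p); split.
move/IHp=> [[|a' A] [B [//= [eqa defp] _ B0 desA desB]]]; rewrite -{}eqa in desA.
by rewrite -defd -desA; exists [:: a, b & A], B; split; rewrite /= ?defp.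
Qed.

(** Read from the right, this is the prefix condition of a Dyck path. *)
Fixpoint ballot (d : seq bool) : bool :=
  if d is b :: d' then (nT d <= nF d) && ballot d' else true.

Lemma ballot_le d : ballot d -> nT d <= nF d.
Proof. by case: d => //= b d /andP[]. Qed.

Lemma ballot_cat d e : ballot d -> ballot e -> ballot (d ++ e).
Proof.
move=> + be; elim: d => //= b d IHd /andP[led /IHd->]; rewrite andbT !count_cat.
by have := ballot_le be; lia.
Qed.

Lemma ballot_catr d e : ballot (d ++ e) -> ballot e.
Proof. by elim: d => //= b d IHd /andP[_ /IHd]. Qed.

(** The final [false] makes up for [c] when [c] is [true]. *)
Lemma ballot_node x c y : ballot x -> ballot y -> ballot (x ++ c :: rcons y false).
Proof.
move=> bx by_; apply: ballot_cat => //=; rewrite -cats1 ballot_cat // andbT !count_cat /=.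
by have := ballot_le by_; lia.
Qed.

(** In each suffix of [d], [true] exceeds [false] by at most one. If the excess is one somewhere,
    the shortest such suffix is [true :: y] with [y] balanced; a positive excess in a suffix of [x]
    would then add up to two. *)
Lemma ballot_rcons_false d : ballot (rcons d false) ->
  ballot d \/ exists x y, [/\ d = x ++ true :: y, ballot x, ballot y & nT y = nF y].
Proof.
elim: d => [|b d IHd] /=; first by left.
rewrite -cats1 !count_cat /= cats1 => /andP[led /[dup] bd /IHd[{}bd|[x [y [defd bx by_ ey]]]]].
  have led' := ballot_le bd.
  case: (leqP (nT (b :: d)) (nF (b :: d))) => /= led''.
    by left; rewrite ?led'' bd.
  right; exists [::], d; case: b led led'' => /=; first by split=> //; lia.
  lia.
right; exists (b :: x), y; split; rewrite ?defd //= bx andbT.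
by move: led; rewrite defd !count_cat /=; lia.
Qed.

Lemma des_node A B n : A != [::] -> B != [::] -> all (ltn^~ n) (A ++ B) ->
  des (A ++ B ++ [:: n]) = des A ++ (head 0 B < last 0 A) :: rcons (des B) false.
Proof.
move=> A0 B0 ltx; rewrite des_cat //; last by case: (B) B0.
have -> : head 0 (B ++ [:: n]) = head 0 B by case: (B) B0.
rewrite des_cat //= -cats1; suff -> : (n < last 0 B) = false by [].
apply: negbTE; rewrite -leqNgt ltnW //; apply: (allP ltx); rewrite mem_cat;
  case: (B) B0 => //= b B' _.
by rewrite mem_last orbT.
Qed.

Lemma des_rcons_max A n : A != [::] -> all (ltn^~ n) A ->
  des (rcons A n) = rcons (des A) false.
Proof.
move=> A0 ltx; rewrite -!cats1 des_cat //=; suff -> : (n < last 0 A) = false by [].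
apply: negbTE; rewrite -leqNgt ltnW //; apply: (allP ltx); case: (A) A0 => //= a A' _.
by rewrite mem_last.
Qed.

Lemma all_stack_sort (a : pred nat) q : all a (stack_sort q) = all a q.
Proof. exact/perm_all/perm_stack_sort. Qed.

Lemma sorted_ballot q : uniq q -> ballot (des (stack_sort q)).
Proof.
move: q; apply: uniq_max_ind => // L n R uq ltx bL bR.
rewrite stack_sort_cat //.
have ltx' : all (ltn^~ n) (stack_sort L ++ stack_sort R).
  by rewrite all_cat !all_stack_sort -all_cat.
have b0 d : ballot d -> ballot (rcons d false) by rewrite -cats1 => /ballot_cat->.
have [A0|A0] := eqVneq (stack_sort L) [::].
  rewrite A0 in ltx' *; have [->//|B0] := eqVneq (stack_sort R) [::].
  by rewrite /= cats1 des_rcons_max // b0.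
have [B0|B0] := eqVneq (stack_sort R) [::].
  by move: ltx'; rewrite B0 cats0 /= cats1 => ltx'; rewrite des_rcons_max // b0.
by rewrite des_node //; apply: ballot_node.
Qed.

(** * Uniqueness of preimages and balanced words *)

Lemma balanced_node x c y : ballot x -> ballot y ->
    nT (x ++ c :: rcons y false) = nF (x ++ c :: rcons y false) ->
  [/\ nT x = nF x, c = true & nT y = nF y].
Proof.
move=> /ballot_le + /ballot_le; rewrite -cats1 !count_cat /= !count_cat /=.
by case: c => /=; split=> //; lia.
Qed.

(* Otherwise the descent at the cut before [B'] starts a suffix of [B] with too many descents. *)
Lemma balanced_cut_le A B A' B' :
    A ++ B = A' ++ B' -> A' != [::] -> B' != [::] ->
    ballot (des B) -> nT (des B') = nF (des B') -> head 0 B' < last 0 A' ->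
  size A' <= size A.
Proof.
move=> eqAB A'0 B'0 bB eB' c'; rewrite leqNgt; apply/negP => ltA.
have def : A' = A ++ drop (size A) A'.
  rewrite -{1}(cat_take_drop (size A) A'); congr (_ ++ _).
  by have := congr1 (take (size A)) eqAB; rewrite take_size_cat // takel_cat // ltnW.
set C := drop (size A) A' in def.
have C0 : C != [::] by rewrite -size_eq0 size_drop; lia.
have defB : B = C ++ B'.
  by move: eqAB; rewrite def -catA => /eqP; rewrite eqseq_cat // eqxx => /eqP.
have lastC : last 0 A' = last 0 C by rewrite def last_cat; case: (C) C0.
move: bB; rewrite defB des_cat // -lastC c' => /ballot_catr/ballot_le /=; lia.
Qed.

Lemma unbalanced_rcons d : ballot d -> nT (rcons d false) != nF (rcons d false).
Proof. by move/ballot_le; rewrite -cats1 !count_cat /=; lia. Qed.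

(** A single nonempty subtree under the root [n] leaves a ballot word followed by an ascent, which
    is not balanced. With two of them, the surplus of ascents is the sum of the two nonnegative
    surpluses, plus 0 if the junction is a descent and 2 otherwise. *)
Lemma balanced_split (X Y : seq nat) n : all (ltn^~ n) (X ++ Y) -> uniq X -> uniq Y ->
  nT (des (rcons (stack_sort X ++ stack_sort Y) n)) =
  nF (des (rcons (stack_sort X ++ stack_sort Y) n)) ->
(X = [::] /\ Y = [::]) \/
[/\ stack_sort X != [::], stack_sort Y != [::],
    nT (des (stack_sort X)) = nF (des (stack_sort X)),
    nT (des (stack_sort Y)) = nF (des (stack_sort Y)) &
    head 0 (stack_sort Y) < last 0 (stack_sort X)].
Proof.
move=> ltXY uX uY.
have ltxs : all (ltn^~ n) (stack_sort X ++ stack_sort Y).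
  by rewrite all_cat !all_stack_sort -all_cat.
have bX := sorted_ballot uX; have bY := sorted_ballot uY.
have [/eqP|A0] := eqVneq (stack_sort X) [::]; last first.
  have [B0|B0] := eqVneq (stack_sort Y) [::]; last first.
    rewrite -cats1 -catA des_node // => /balanced_node.
    by case=> // e1 e2 e3; right; split.
  move: ltxs; rewrite B0 cats0 => ltxs; rewrite des_rcons_max // => bal.
  by have := unbalanced_rcons bX; rewrite bal eqxx.
rewrite stack_sort_eq0 => /eqP X0; move: ltxs; rewrite X0 /= => ltxs.
have [/eqP|B0] := eqVneq (stack_sort Y) [::].
  by rewrite stack_sort_eq0 => /eqP ->; left.
rewrite des_rcons_max // => bal.
by have := unbalanced_rcons bY; rewrite bal eqxx.
Qed.

(** Both preimages have the last letter as root, so only the cut between the images of the two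
    subtrees could differ. [balanced_cut_le], used both ways, makes the cuts equal, and induction
    applies to the subtrees. *)
Lemma sorted_balanced_inj (q q' : seq nat) : uniq q ->
    nT (des (stack_sort q)) = nF (des (stack_sort q)) ->
  stack_sort q = stack_sort q' -> q = q'.
Proof.
move=> uq; move: q uq q'; apply: uniq_max_ind => [q' _ /esym/eqP|L n R uq ltx IHL IHR q' + eqs].
  by rewrite stack_sort_eq0 => /eqP->.
have uq' : uniq q' by rewrite -stack_sort_uniq -eqs stack_sort_uniq.
move: q' uq' eqs; apply: uniq_max_ind => [/eqP|L' n' R' uq' ltx' _ _ eqs].
  by rewrite stack_sort_eq0; case: (L).
move: (eqs); rewrite !stack_sort_cat // !catA !cats1 => /rcons_inj[eqAB <-].
have [uL uR _ _] := uniq_node uq; have [uL' uR' _ _] := uniq_node uq'.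
move=> bal; have := bal; rewrite eqAB => bal'.
have {}ltx' : all (ltn^~ n) (L' ++ R').
  rewrite all_cat -(all_stack_sort _ L') -(all_stack_sort _ R') -all_cat -eqAB.
  by rewrite all_cat !all_stack_sort -all_cat.
case: (balanced_split ltx uL uR bal) => [[L0 R0]|[A0 B0 eA eB c]];
  case: (balanced_split ltx' uL' uR' bal') => [[L0' R0']|[A0' B0' eA' eB' c']].
- by rewrite L0 R0 L0' R0'.
- by move: eqAB A0'; rewrite L0 R0; case: (stack_sort L').
- by move: eqAB A0; rewrite L0' R0'; case: (stack_sort L).
have szA : size (stack_sort L) = size (stack_sort L').
  apply/eqP; rewrite eqn_leq (balanced_cut_le (esym eqAB) A0 B0 _ eB c) ?sorted_ballot //.
  by rewrite (balanced_cut_le eqAB A0' B0' _ eB' c') ?sorted_ballot.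
move/eqP: eqAB; rewrite eqseq_cat // => /andP[/eqP eqA /eqP eqB].
by rewrite (IHL L') // (IHR R').
Qed.

(** [q] is grafted at the lower left of the decreasing tree of [q']: its letters lie below the first
    letter of [stack_sort q'], hence below every root passed on the way. The default [a.+1] makes
    the hypothesis vacuous for empty [q']. *)
Lemma sorted_join (q q' : seq nat) : uniq q' ->
    (forall a : nat, a \in q -> a < head a.+1 (stack_sort q')) ->
  exists z, stack_sort z = stack_sort q ++ stack_sort q'.
Proof.
move=> uq; move: q' uq q; apply: uniq_max_ind => [|L n R uq ltx IHL IHR] q lt_q.
  by exists q; rewrite cats0.
have lt_n a : a \in q -> a < n.
  move/lt_q; rewrite stack_sort_cat // => /leq_trans; apply.
  have: all (leq^~ n) (stack_sort L ++ stack_sort R ++ [:: n]).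
    apply/allP=> x; rewrite catA mem_cat inE orbC => /predU1P[->//|xLR].
    by apply/ltnW/(allP ltx); move: xLR; rewrite !mem_cat !mem_stack_sort.
  by rewrite !catA !cats1 headI /= => /andP[].
have [L0|L0] := eqVneq L [::].
  rewrite L0 in ltx lt_q uq *.
  (* With [L] empty, moving [R] to the left of [n] keeps the image, and [q] joins it there. *)
  have [a /lt_q|z sz] := IHR q.
    by rewrite (@stack_sort_cat [::]) //=; case: (stack_sort R).
  exists (z ++ n :: [::]); rewrite !stack_sort_cat //= ?cats0; last first.
    by rewrite -all_stack_sort sz all_cat !all_stack_sort ltx andbT; apply/allP.
  by rewrite sz -catA.
have [a /lt_q|z sz] := IHL q.
  by move: L0; rewrite -stack_sort_eq0 stack_sort_cat //; case: (stack_sort L).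
exists (z ++ n :: R); rewrite !stack_sort_cat ?sz -?catA //.
move: ltx; rewrite !all_cat -(all_stack_sort _ z) sz all_cat !all_stack_sort.
by case/andP=> -> ->; rewrite !andbT; apply/allP.
Qed.

(** A lone subtree could change sides, giving a second preimage, so the subtrees are both empty or
    both nonempty. In the latter case each is the only preimage of its image, hence balanced by
    induction, and the descent at the junction compensates the final ascent. *)
Lemma uniquely_sorted_balanced (q : seq nat) : uniq q ->
    (forall q', stack_sort q' = stack_sort q -> q' = q) ->
  nT (des (stack_sort q)) = nF (des (stack_sort q)).
Proof.
move: q; apply: uniq_max_ind => // L n R uq ltx IHL IHR uniq_pre.
have [uL uR nLR uLR] := uniq_node uq.
have [nL nR] : n \notin L /\ n \notin R.
  by move: nLR; rewrite mem_cat negb_or => /andP.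
have notlast z : L ++ n :: R = z ++ [:: n] -> R = [::].
  case/lastP: (R) nR => // R' r; rewrite mem_rcons inE negb_or => /andP[+ _].
  rewrite -rcons_cons -rcons_cat cats1 => + /rcons_inj[_ eqrn].
  by rewrite eqrn eqxx.
have ltz z : stack_sort z = stack_sort L ++ stack_sort R -> all (ltn^~ n) (z ++ [::]).
  by move=> sz; rewrite cats0 -all_stack_sort sz all_cat !all_stack_sort -all_cat.
have nojoin z : stack_sort z = stack_sort L ++ stack_sort R -> R = [::].
  move=> sz; apply: (notlast z); symmetry; apply: uniq_pre.
  by rewrite !stack_sort_cat ?ltz // sz -catA.
have [L0|L0] := eqVneq L [::].
  by rewrite L0 (nojoin R) ?L0.
have [R0|R0] := eqVneq R [::].
  have /uniq_pre: stack_sort ([::] ++ n :: L) = stack_sort (L ++ n :: R).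
    by rewrite !stack_sort_cat ?R0 //=; move: ltx; rewrite R0 cats0.
  by case: (L) L0 nL => //= l L' _ nL [eqnl _]; rewrite eqnl mem_head in nL.
have eL : nT (des (stack_sort L)) = nF (des (stack_sort L)).
  apply: IHL => // q' sq'; have := uniq_pre (q' ++ n :: R).
  have ltx' : all (ltn^~ n) (q' ++ R).
    by rewrite all_cat -all_stack_sort sq' all_stack_sort -all_cat.
  rewrite !stack_sort_cat ?sq' // => /(_ erefl)/eqP.
  by rewrite eqseq_cat -?[size q']stack_sort_size ?sq' ?stack_sort_size // => /andP[/eqP].
have eR : nT (des (stack_sort R)) = nF (des (stack_sort R)).
  apply: IHR => // q' sq'; have := uniq_pre (L ++ n :: q').
  have ltx' : all (ltn^~ n) (L ++ q').
    by rewrite all_cat -(all_stack_sort _ q') sq' all_stack_sort -all_cat.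
  rewrite !stack_sort_cat ?sq' // => /(_ erefl)/eqP.
  by rewrite eqseq_cat // eqxx => /eqP[].
rewrite stack_sort_cat // des_node ?stack_sort_eq0 //; last first.
  by rewrite all_cat !all_stack_sort -all_cat.
suff c : head 0 (stack_sort R) < last 0 (stack_sort L).
  by rewrite c -cats1 !count_cat /= !count_cat /=; lia.
(* Without a descent at the junction, all letters of [L] lie below the first letter of
   [stack_sort R]; [sorted_join] then yields a preimage ending in [n], which forces [R] to be
   empty. *)
have [//|lec] := ltnP.
have [a aL|z /nojoin R0'] := @sorted_join L R uR; last by rewrite R0' in R0.
have := stack_sort_le_last uL aL; move: lec R0; rewrite -stack_sort_eq0.
case E: (stack_sort R) => [|b s] //= lec _ lea; rewrite ltn_neqAle (leq_trans lea lec) andbT.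
have bR : b \in R by rewrite -mem_stack_sort E mem_head.
apply: contraTneq uLR => eqab; rewrite cat_uniq; apply/negP => /and3P[_ /hasP nh _].
by apply: nh; exists b; rewrite // -eqab.
Qed.

(** * Sorted words avoiding 312 *)

Definition avoids312 (p : seq nat) : Prop :=
  forall a b c, subseq [:: c; a; b] p -> ~ (a < b < c).

Lemma avoids312P p : reflect (avoids312 p) (avoids p [:: 3; 1; 2]).
Proof.
apply: (iffP negP) => [ncont a b c sub ltabc|av /containsP[u sub /andP[/eqP]]].
  apply/ncont/containsP; exists [:: c; a; b] => //; rewrite /same_order /=.
  apply/forallP => -[[|[|[|i]]] lti] //; apply/forallP => -[[|[|[|j]]] ltj] //=;
    apply/eqP; lia.
case: u sub => [|c [|a [|b [|? ?]]]] //= sub _ /forallP ord.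
apply: (av _ _ _ sub).
have /forallP o1 := ord (@Ordinal 3 1 isT); have /forallP o2 := ord (@Ordinal 3 2 isT).
by have /eqP /= -> := o1 (@Ordinal 3 2 isT); have /eqP /= -> := o2 (@Ordinal 3 0 isT).
Qed.

Lemma avoids312_subseq p q : subseq p q -> avoids312 q -> avoids312 p.
Proof. by move=> sub av a b c /subseq_trans/(_ sub)/av. Qed.

(** The last letter [n] is the maximum. If the rest [t] is ballot, [n] is appended to a preimage of
    [t]; otherwise [ballot_rcons_false] cuts [t] into two ballot words, whose preimages become the
    subtrees of [n]. *)
Lemma avoids312_sorted (p : seq nat) : uniq p -> avoids312 p -> ballot (des p) ->
  exists q, stack_sort q = p.
Proof.
have [m] := ubnP (size p); elim: m p => // m IHm p lepm up av bp.
case/lastP: p => [|t n] in lepm up av bp *; first by exists [::].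
move: lepm; rewrite size_rcons ltnS => lttm.
have [nt ut] : n \notin t /\ uniq t by move: up; rewrite rcons_uniq => /andP.
have subt r : subseq r t -> avoids312 r.
  by move=> /subseq_trans/(_ (subseq_rcons t n)) sub; apply: avoids312_subseq av.
have [t0|t0] := eqVneq t [::]; first by exists [:: n]; rewrite t0 (@stack_sort_cat [::] n [::]).
have lastt : last 0 t \in t by case: (t) t0 => //= a s _; rewrite mem_last.
have neqn x : x \in t -> x != n by apply: contraTneq => ->.
have ltn_last : last 0 t < n.
  rewrite ltn_neqAle neqn //= leqNgt; apply/negP => ltnl.
  by move: bp; rewrite -cats1 des_cat //= ltnl => /ballot_catr.
(* A letter [x > n] of [t] would form a 312 with the last letter of [t] and [n]. *)
have ltx : all (ltn^~ n) t.
  apply/allP => x xt /=; rewrite ltn_neqAle neqn //= leqNgt; apply/negP => ltnx.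
  apply: (av (last 0 t) n x); last by rewrite ltn_last ltnx.
  rewrite -[[:: x; _; _]]/(rcons [:: x; last 0 t] n) -!cats1 cat_subseq //.
  move: ltnx ltn_last; case/lastP: (t) xt => // t' l; rewrite last_rcons mem_rcons inE.
  case/predU1P=> [-> lt1 lt2|]; first by have := ltn_trans lt1 lt2; rewrite ltnn.
  move=> xt' _ _; rewrite -cats1 -[[:: x; l]]/([:: x] ++ [:: l]) cat_subseq // sub1seq //.
move: bp; rewrite des_rcons_max // => /ballot_rcons_false[bt|[x [y [dest bx by_ ey]]]].
  have [//|q sq] := IHm t lttm ut (subt _ _) bt.
  by exists (q ++ n :: [::]); rewrite stack_sort_cat ?sq ?cats1 // cats0 -all_stack_sort sq.
have [A [B [deft A0 B0 desA desB]]] := des_split dest.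
have [szA szB] : size A < m /\ size B < m.
  by move: lttm A0 B0; rewrite deft size_cat -!size_eq0 -!lt0n => ltm A0 B0; split; lia.
move: ut; rewrite deft cat_uniq => /and3P[uA _ uB].
have [||zA sA] := IHm A szA uA _; first by apply: subt; rewrite deft prefix_subseq.
  by rewrite desA.
have [||zB sB] := IHm B szB uB _; first by apply: subt; rewrite deft suffix_subseq.
  by rewrite desB.
exists (zA ++ n :: zB); rewrite stack_sort_cat ?sA ?sB ?catA ?cats1 //.
by rewrite all_cat -(all_stack_sort _ zA) -(all_stack_sort _ zB) sA sB -all_cat -deft.
Qed.

Lemma avoids312_uniquely_sorted (p : seq nat) : uniq p -> avoids312 p ->
  uniquely_sorted p = ballot (des p) && (nT (des p) == nF (des p)).
Proof.
move=> up av; apply/uniquely_sortedP/andP => [[q sq uniq_q]|[bp /eqP balp]].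
  have uq : uniq q by rewrite -stack_sort_uniq sq.
  by rewrite -sq sorted_ballot // uniquely_sorted_balanced // sq.
have [q sq] := avoids312_sorted up av bp; exists q => // q' sq'; symmetry.
by apply: sorted_balanced_inj; rewrite ?sq // -stack_sort_uniq sq.
Qed.

(** * Descent words of 312-avoiding permutations *)

(** The Stanley order in suffix form: [rev_neg] turns counts of [false] in suffixes into counts of
    [U] in prefixes. *)
Fixpoint dom (d e : seq bool) : bool :=
  match d, e with
  | [::], [::] => true
  | _ :: d', _ :: e' => (nF d <= nF e) && dom d' e'
  | _, _ => false
  end.

Definition edom (d e : seq bool) : bool := dom d e && (nF d == nF e).

Lemma dom_size d e : dom d e -> size d = size e.
Proof. by elim: d e => [|b d IHd] [|c e] //= /andP[_ /IHd->]. Qed.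

Lemma dom_le d e : dom d e -> nF d <= nF e.
Proof. by case: d e => [|b d] [|c e] //= /andP[]. Qed.

Lemma nF_rem e : false \in e -> nF e = (nF (rem false e)).+1.
Proof. by elim: e => //= -[] e IHe //= /IHe ->. Qed.

(** [rem false e] and [behead e] agree after the first [false] of [e]. On longer suffixes both have
    at least [nF (rem false e)] letters [false], which bounds the count in every suffix of [d]. *)
Lemma dom_rem d e : false \in e -> nF d <= nF (rem false e) ->
  dom d (rem false e) = dom d (behead e).
Proof.
elim: e d => [|[] e IHe] [|b d] //=; first by case: e IHe => // c e _ _; case: (c).
rewrite inE /= => fe led; case: e => [|c e] in fe IHe led *; first by [].
rewrite led /=; rewrite IHe //=; last first.
  by apply: leq_trans led; rewrite leq_addl.
suff -> : nF (b :: d) <= nF (c :: e) by [].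
by apply: leq_trans led _; rewrite (nF_rem fe).
Qed.

(** If [e] began with [false], its tail would have one [false] less than [d], against domination of
    the tails. *)
Lemma edom_true d e : edom (true :: d) e -> exists2 e', e = true :: e' & edom d e'.
Proof.
case: e => [|[] e] // /andP[] /= /andP[led dde] eqF.
  by exists e => //; exact/andP.
by exfalso; have := dom_le dde; rewrite /=; lia.
Qed.

Lemma edom_consT d e : edom (true :: d) (true :: e) = edom d e.
Proof.
rewrite /edom /=; case dde: (dom d e); rewrite ?andbF //= andbT !add0n.
by rewrite (dom_le dde).
Qed.

Lemma edom_false d e : edom (false :: d) e -> false \in e /\ edom d (rem false e).
Proof.
case/andP=> dde /eqP eqF.
have fe : false \in e.
  have: 0 < nF e by rewrite -eqF.
  by rewrite -has_count => /hasP[[]].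
have eqF' : nF d = nF (rem false e) by move: eqF; rewrite (nF_rem fe) => -[].
rewrite fe /edom dom_rem ?eqF' // eqxx andbT; split=> //.
by case: e dde {fe eqF eqF'} => //= c e /andP[].
Qed.

Lemma edom_rem d e : false \in e -> edom d (rem false e) -> edom (false :: d) e.
Proof.
move=> fe /andP[dde /eqP eqF]; move: dde; rewrite dom_rem ?eqF // /edom.
have eqF' : nF (false :: d) = nF e by rewrite (nF_rem fe) -eqF.
by rewrite eqF' eqxx andbT; case: e fe eqF eqF' => // c e _ _ /= -> ->; rewrite leqnn.
Qed.

(* [v] is the first letter of the permutation; removing it and standardizing
   deletes the first letter [b] of [d] and the first [b] of [e]. *)
Fixpoint build (d e : seq bool) : seq nat :=
  if d is b :: d' then
    let v := (index false e).+1 in v :: map (bump v) (build d' (rem b e))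
  else [:: 1].

(** For a permutation [p] of [1..n], the descent word of its inverse: a descent at [w] means that
    [w.+1] stands to the left of [w]. *)
Definition ides (p : seq nat) : seq bool :=
  [seq index w.+1 p < index w p | w <- iota 1 (size p).-1].

Lemma size_build d e : size (build d e) = (size d).+1.
Proof. by elim: d e => //= b d IHd e; rewrite size_map IHd. Qed.

Lemma head_build d e : size d = size e -> head 0 (build d e) = (index false e).+1.
Proof. by case: d => //= /esym/size0nil ->. Qed.

Lemma edom_cons b d e : edom (b :: d) e -> b \in e /\ edom d (rem b e).
Proof.
case: b => [/edom_true[e' -> dde]|/edom_false //].
by rewrite mem_head /=.
Qed.

(** * Descents and 312-avoidance of the built permutation *)

Lemma perm_bump v n q : 0 < v <= n.+1 -> perm_eq q (iota 1 n) ->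
  perm_eq (v :: map (bump v) q) (iota 1 n.+1).
Proof.
move=> ltv pq; have vq : v \notin map (bump v) q.
  by apply/mapP=> -[x _]; rewrite /bump; lia.
have uq : uniq (v :: map (bump v) q).
  rewrite /= vq map_inj_uniq; last exact: (can_inj (bumpK v)).
  by rewrite (perm_uniq pq) iota_uniq.
apply: uniq_perm; rewrite ?iota_uniq // => w; rewrite mem_iota.
rewrite inE; case: eqVneq => [->|neqw] /=; first by lia.
apply/mapP/idP => [[x + ->]|ltw]; first by rewrite (perm_mem pq) mem_iota /bump; lia.
exists (unbump v w); first by rewrite (perm_mem pq) mem_iota /unbump; lia.
by rewrite unbumpK.
Qed.

Lemma perm_build d e : edom d e -> perm_eq (build d e) (iota 1 (size d).+1).
Proof.
elim: d e => //= b d IHd e dde; have [be {}/IHd IHd] := edom_cons dde.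
apply: (@perm_bump _ (size d).+1) => //=; rewrite ltnS.
by case/andP: dde => /dom_size /= -> _; rewrite index_size.
Qed.

Lemma bump_lt v : {mono bump v : x y / x < y}.
Proof. by move=> x y; rewrite /bump; lia. Qed.

Lemma des_map_bump v q : des (map (bump v) q) = des q.
Proof.
case: q => //= x q; elim: q x => //= y q IHq x; by rewrite bump_lt IHq.
Qed.

(** Let [v] and [x] be the first letters of the word and of its standardized tail. If [b] is [true],
    [e] loses its leading [true] and [x = v - 1]. If [b] is [false], the first [false] can only move
    right, so [x >= v] and [bump] lifts [x] above [v]. *)
Lemma des_build d e : edom d e -> des (build d e) = d.
Proof.
elim: d e => //= b d IHd e dde; have [be dde'] := edom_cons dde.
have := IHd _ dde'; have := head_build (dom_size (andP dde').1).
case E: (build _ _) => [|x q]; first by have := size_build d (rem b e); rewrite E.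
move=> /= eqx; have := des_map_bump (index false e).+1 (x :: q).
move=> /= -> ->; congr (_ :: _); rewrite eqx.
case: b be dde {dde' E} eqx => be dde eqx.
  by have [e' -> _] := edom_true dde; rewrite /= /bump; lia.
suff: index false e <= index false (rem false e) by rewrite /bump; lia.
by elim: (e) => //= -[] e' IHe //=; lia.
Qed.
Lemma nth_ides p i : i < (size p).-1 ->
  nth false (ides p) i = (index i.+2 p < index i.+1 p).
Proof. by move=> lti; rewrite (nth_map 0) ?size_iota // nth_iota. Qed.

Lemma size_ides p : size (ides p) = (size p).-1.
Proof. by rewrite size_map size_iota. Qed.

Lemma index_cons_bump v w q : w != v ->
  index w (v :: map (bump v) q) = (index (unbump v w) q).+1.
Proof.
move=> neqw; rewrite /= eq_sym (negPf neqw) -{1}(@unbumpK v w) //.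
by rewrite index_map //; apply: can_inj (bumpK v).
Qed.

Lemma nth_before_false e i : i < index false e -> nth false e i = true.
Proof. by elim: e i => //= -[] e IHe [|i] //= /IHe. Qed.

Lemma index_rem_false b d e : edom (b :: d) e ->
  index false e <= (index false (rem b e)).+1.
Proof.
case: b => [/edom_true[e' -> _] //=|_].
by elim: e => //= -[] e IHe //=.
Qed.

Lemma nth_rem b d e i : edom (b :: d) e -> index false e <= i ->
  nth false (rem b e) i = nth false e i.+1.
Proof.
case: b => [/edom_true[e' -> _] //=|_].
by elim: e i => [|[] e IHe] i /=; rewrite ?nth_nil //; case: i => // i /IHe.
Qed.

(** As [v] stands first, the inverse has no descent at [v] and one at [v - 1], like [e] around its
    first [false]. Other neighbouring values are compared in the tail: below [v] they are unchanged
    and the letters are [true]; above [v] they shift by one, as the letters of [e] do when [b] is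
    removed. *)
Lemma ides_build d e : edom d e -> ides (build d e) = e.
Proof.
elim: d e => [|b d IHd] e dde; first by case/andP: dde; case: e.
have [be dde'] := edom_cons dde; have sz := dom_size (andP dde).1.
apply: (@eq_from_nth _ false) => [|i]; rewrite size_ides size_build //= => lti.
rewrite nth_ides; last by rewrite /= size_map size_build.
rewrite /build -/build.
set v := (index false e).+1; set q := build _ _ in IHd *.
have nthq j : j < size d -> (index j.+2 q < index j.+1 q) = nth false (rem b e) j.
  by move=> ltj; rewrite -(IHd _ dde') nth_ides // size_build.
have [eqi|nei] := eqVneq i.+1 v.
  rewrite eqi /= eqxx ltn0; move: eqi => [->]; symmetry.
  by elim: (e) => //= -[].
have [eqi|nei'] := eqVneq i.+2 v.
  rewrite eqi /= eqxx eq_sym (negPf nei); symmetry; apply: nth_before_false.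
  by move: eqi => [<-].
rewrite !index_cons_bump // ltnS; move: nei nei'; rewrite /v !eqSS => nei nei'.
have [lti'|gei] := ltnP i (index false e).
  have -> : unbump (index false e).+1 i.+2 = i.+2 by rewrite /unbump; lia.
  have -> : unbump (index false e).+1 i.+1 = i.+1 by rewrite /unbump; lia.
  have ler := index_rem_false dde.
  rewrite nthq ?nth_before_false //; first by lia.
  by have := index_size false e; rewrite -sz /=; lia.
have -> : unbump (index false e).+1 i.+2 = i.+1 by rewrite /unbump; lia.
have -> : unbump (index false e).+1 i.+1 = i by rewrite /unbump; lia.
case: i lti gei nei {nei'} => [|i] lti gei nei; first by lia.
by rewrite nthq // (nth_rem dde) //; lia.
Qed.

Lemma ides_prefix_decr q l a b : l <= (size q).-1 ->
    (forall j, j < l -> nth false (ides q) j) ->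
  0 < a < b -> b <= l.+1 -> index b q < index a q.
Proof.
move=> lel decr /andP[a0]; elim: b => // b IHb; rewrite ltnS leq_eqVlt => ab ltb.
have step : index b.+1 q < index b q.
  have b0 : 0 < b by case/predU1P: ab => [<-//|/(leq_ltn_trans _)->].
  case: b b0 ltb {IHb ab} => // b _; rewrite ltnS => ltb.
  by have := decr b ltb; rewrite nth_ides // (leq_trans ltb).
case/predU1P: ab => [-> //|ab]; apply: ltn_trans step (IHb ab _); exact: ltnW.
Qed.

Lemma subseq2_index (a b : nat) q : uniq q -> subseq [:: a; b] q ->
  index a q < index b q.
Proof.
elim: q => //= x q IHq /andP[xq uq]; have [_|_] := eqVneq a x.
  rewrite sub1seq; have [<-|//] := eqVneq x b.
  by rewrite (negPf xq).
move=> sub.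
have bq : b \in q by apply: (mem_subseq sub); rewrite !inE eqxx orbT.
by have [eqb|_] := eqVneq x b; [rewrite eqb bq in xq | rewrite ltnS IHq].
Qed.

Lemma subseq_map_bump v s q : subseq s (map (bump v) q) ->
  exists2 s', s = map (bump v) s' & subseq s' q.
Proof.
by case/subseqP=> m _ ->; rewrite -map_mask; exists (mask m q); rewrite ?mask_subseq.
Qed.

Lemma avoids312_bump v q : avoids312 q -> avoids312 (map (bump v) q).
Proof.
move=> av a b c /subseq_map_bump[[|c' [|a' [|b' [|? ?]]]] //= [-> -> ->] sub].
by rewrite !bump_lt; apply: av.
Qed.

Lemma avoids312_cons v q : avoids312 q ->
  (forall a b, subseq [:: a; b] q -> ~ (a < b < v)) -> avoids312 (v :: q).
Proof.
move=> avq avv a b c /=; case: eqVneq => [-> /avv //|_ sub]; exact: avq.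
Qed.

(** A 312 led by [v] needs two values below [v] in increasing order in the tail. But [e] starts with
    [v - 1] letters [true], so [rem b e] starts with at least [v - 2], and the values [1] to [v - 1]
    appear in decreasing order. *)
Lemma avoids312_build d e : edom d e -> avoids312 (build d e).
Proof.
elim: d e => [|b d IHd] e dde; first by move=> a b c /=; case: ifP.
have [be dde'] := edom_cons dde; apply: avoids312_cons => [|x y]; first exact/avoids312_bump/IHd.
case/subseq_map_bump=> -[|x' [|y' [|? ?]]] //= [-> ->] sub /andP[ltxy lty].
have pq := perm_build dde'; have uq : uniq (build d (rem b e)) by rewrite (perm_uniq pq) iota_uniq.
have := subseq2_index uq sub; apply/negP; rewrite -leqNgt ltnW //.
have x0 : 0 < x'.
  have : x' \in build d (rem b e) by apply: (mem_subseq sub); rewrite mem_head.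
  by rewrite (perm_mem pq) mem_iota => /andP[].
apply: (@ides_prefix_decr _ (index false e).-1); rewrite ?size_build.
- by have := index_size false e; rewrite -(dom_size (andP dde).1) /=; lia.
- move=> j ltj; rewrite ides_build // nth_before_false //.
  by have := index_rem_false dde; lia.
- by rewrite x0 -(bump_lt (index false e).+1).
- by move: lty; rewrite /bump; lia.
Qed.

(** * Recovering the pair of words from the permutation *)

Lemma index_insert_false k e : k <= index false e ->
  index false (take k e ++ false :: drop k e) = k /\
  rem false (take k e ++ false :: drop k e) = e.
Proof.
elim: k e => [|k IHk] [|[] e] //=.
by rewrite ltnS => /IHk[-> ->].
Qed.

Lemma avoids312_buildP n p : perm_eq p (iota 1 n.+1) -> avoids312 p ->
  exists d e, [/\ size d = n, edom d e & p = build d e].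
Proof.
elim: n p => [|n IHn] p pp av.
  by exists [::], [::]; split=> //; exact: perm_small_eq pp.
case: p => [|v q] in pp av *; first by have := perm_size pp; rewrite size_iota.
have /= /andP[vq uq] : uniq (v :: q) by rewrite (perm_uniq pp) iota_uniq.
have memP w : (w \in v :: q) = (0 < w < n.+3) by rewrite (perm_mem pp) mem_iota.
pose p' := map (unbump v) q.
have defq : q = map (bump v) p'.
  rewrite -map_comp map_id_in // => w wq /=; rewrite unbumpK //.
  by rewrite inE; apply: contraNneq vq => <-.
have up' : uniq p' by move: uq; rewrite {1}defq => /map_uniq.
have v0 : 0 < v < n.+3 by rewrite -memP mem_head.
have pp' : perm_eq p' (iota 1 n.+1).
  apply: uniq_perm; rewrite ?iota_uniq // => w; rewrite mem_iota.
  rewrite -(mem_map (can_inj (bumpK v))) -defq.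
  have : (bump v w \in v :: q) = (bump v w \in q) by rewrite inE eq_sym (negPf (neq_bump v w)).
  by rewrite memP => <-; move: v0; rewrite /bump; lia.
have avp' : avoids312 p'.
  move=> a b c sub; rewrite -(bump_lt v a) -(bump_lt v b); apply: av.
  apply: subseq_trans (subseq_cons q v); rewrite defq.
  exact: (map_subseq (bump v) sub).
have [d [e [szd dde defp']]] := IHn p' pp' avp'.
have szde := dom_size (andP dde).1.
have hd := head_build szde; rewrite -defp' in hd.
case: (leqP v (head 0 p')) => [lev|ltv].
  (* The head of [p'] is [(index false e).+1], so a [false] inserted at index [v.-1] becomes the
     first one and encodes [v]. *)
  have [|idx remE] := @index_insert_false v.-1 e; first by rewrite hd in lev; lia.
  exists (false :: d), (take v.-1 e ++ false :: drop v.-1 e); split.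
  - by rewrite /= szd.
  - by apply: edom_rem; rewrite ?remE // mem_cat mem_head orbT.
  - by rewrite /= idx remE prednK -?defp' -?defq //; case/andP: v0.
exists (true :: d), (true :: e); split; rewrite ?edom_consT //=; first by rewrite szd.
suff eqv : v = (head 0 p').+1 by rewrite -defp' -hd -eqv -defq.
apply/eqP; rewrite eqn_leq ltv andbT leqNgt.
(* If [v] exceeded the head of [p'] by more than one, then [v], this head and its successor would
   form a 312. *)
apply/negP => ltv'; apply: (av (head 0 p') (head 0 p').+1 v); last by rewrite ltnSn ltv'.
rewrite /= eqxx.
have : (head 0 p').+1 \in v :: q by rewrite memP; lia.
rewrite inE (ltn_eqF ltv') /= defq.
case: (p') ltv {hd} => //= x s ltv.
have -> : bump v x = x by rewrite /bump; lia.
by rewrite eqxx inE gtn_eqF //= sub1seq.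
Qed.

(** * From descent words to Dyck paths *)

Lemma ballotP d : reflect (forall j, nT (drop j d) <= nF (drop j d)) (ballot d).
Proof.
apply: (iffP idP) => [bd j|].
  by move: bd; rewrite -{1}(cat_take_drop j d) => /ballot_catr/ballot_le.
elim: d => //= b d IHd le_d; apply/andP; split; first exact: le_d 0.
by apply: IHd => j; apply: le_d j.+1.
Qed.

Lemma domP d e : size d = size e ->
  reflect (forall j, nF (drop j d) <= nF (drop j e)) (dom d e).
Proof.
move=> sz; apply: (iffP idP) => [+ j|le_d].
  by elim: d e j {sz} => [|b d IHd] [|c e] [|j] //= /andP[led]; [|apply: IHd].
elim: d e sz le_d => [|b d IHd] [|c e] //= [sz] le_d; apply/andP; split; first exact: le_d 0.
by apply: IHd => // j; apply: le_d j.+1.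
Qed.

(* The paper reads descent sets from right to left, with U for a non-descent. *)
Definition rev_neg (d : seq bool) : seq bool := rev (map negb d).

Lemma rev_negK : involutive rev_neg.
Proof. by move=> d; rewrite /rev_neg map_rev revK mapK //; apply: negbK. Qed.

Lemma size_rev_neg d : size (rev_neg d) = size d.
Proof. by rewrite size_rev size_map. Qed.

Lemma nth_rev_neg d i : i < size d ->
  nth false (rev_neg d) i = ~~ nth false d (size d - i.+1).
Proof.
move=> lti; rewrite /rev_neg nth_rev size_map // (nth_map false) //.
by rewrite subnSK // leq_subr.
Qed.

Lemma take_rev_neg i d : take i (rev_neg d) = rev_neg (drop (size d - i) d).
Proof. by rewrite /rev_neg take_rev size_map map_drop. Qed.

Lemma countU_rev_neg d : count_mem U (rev_neg d) = nF d.
Proof. by rewrite count_rev count_map; apply: eq_count => -[]. Qed.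

Lemma countD_rev_neg d : count_mem D (rev_neg d) = nT d.
Proof. by rewrite count_rev count_map; apply: eq_count => -[]. Qed.

Lemma nT_nF d : nT d + nF d = size d.
Proof. by rewrite -(count_predC id). Qed.

Lemma dyck_rev_neg k d :
  (rev_neg d \in dyck k) = [&& size d == k.*2, nT d == nF d & ballot d].
Proof.
rewrite inE countU_rev_neg countD_rev_neg size_rev_neg.
have -> : all (fun i => count_mem D (take i (rev_neg d)) <= count_mem U (take i (rev_neg d)))
            (iota 0 (size d).+1) = ballot d.
  apply/allP/ballotP => [le_d j|le_d i _]; last first.
    by rewrite take_rev_neg countU_rev_neg countD_rev_neg.
  have [ltj|/drop_oversize-> //] := ltnP j (size d).
  have := le_d (size d - j); rewrite mem_iota ltnS leq_subr => /(_ isT).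
  by rewrite take_rev_neg countU_rev_neg countD_rev_neg subKn // ltnW.
rewrite -nT_nF andbA [RHS]andbA; congr (_ && _).
by apply/andP/andP=> -[/eqP ? /eqP ?]; split; apply/eqP; lia.
Qed.

Lemma stanley_le_rev_neg k d e : size d = k.*2 -> size e = k.*2 ->
  stanley_le k (rev_neg d) (rev_neg e) = dom d e.
Proof.
move=> szd sze; apply/allP/(domP (etrans szd (esym sze))) => [le_d j|le_d i _]; last first.
  by rewrite !take_rev_neg !countU_rev_neg szd sze.
have [ltj|lej] := ltnP j k.*2; last by rewrite !drop_oversize ?szd ?sze.
have := le_d (k.*2 - j); rewrite mem_iota => le_dj.
move: le_dj; rewrite !take_rev_neg !countU_rev_neg szd sze subKn ?(ltnW ltj) //.
by apply; lia.
Qed.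

Lemma nth_des p i : i < (size p).-1 -> nth false (des p) i = (nth 0 p i.+1 < nth 0 p i).
Proof.
case: p => //= x q lti; rewrite (nth_pairmap 0) //.
Qed.

Lemma nth_rot_word p i : i < size p ->
  nth 0 (rot_word p) i = (index (size p - i) p).+1.
Proof.
move=> lti; have szi : size (inv_word p) = size p by rewrite size_map size_iota.
rewrite nth_rev szi // (nth_map 0) ?size_iota ?subnSK ?leq_subr //.
by rewrite nth_iota ?subnSK ?leq_subr // add1n -subSn.
Qed.

(** [rot_word] reverses the inverse, so its descents at [i] are the ascents of the inverse at
    [n - i]; hence both paths are reversed descent words with [U] for an ascent. *)
Lemma DL_des_ides k p : is_perm_word k.*2.+1 p ->
  DL k p = (rev_neg (des p), rev_neg (ides p)).
Proof.
move=> pp; have szp : size p = k.*2.+1 by rewrite (perm_size pp) size_iota.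
have szdes : size (des p) = k.*2 by rewrite size_des szp.
have szides : size (ides p) = k.*2 by rewrite size_ides szp.
rewrite /DL; congr (_, _); apply: (@eq_from_nth _ false);
  rewrite size_map size_iota ?size_rev_neg // => i lti.
- rewrite (nth_map 0) ?size_iota // nth_iota // nth_rev_neg szdes //.
  rewrite nth_des ?szp /=; last by lia.
  rewrite inE szp /letter add1n subSS.
  have -> : 0 < k.*2 - i < k.*2.+1 by lia.
  have -> : (k.*2 - i) = (k.*2 - i.+1).+1 by lia.
  by rewrite /=; case: ifP.
- rewrite (nth_map 0) ?size_iota // nth_iota // nth_rev_neg szides //.
  rewrite nth_ides ?szp /=; last by lia.
  have sz_rot : size (rot_word p) = k.*2.+1 by rewrite size_rev size_map size_iota.
  rewrite inE /letter sz_rot add1n !nth_rot_word szp /=; try lia.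
  have -> : i.+1 < k.*2.+1 by lia.
  have -> : k.*2.+1 - i = (k.*2 - i.+1).+2 by lia.
  have -> : k.*2.+1 - i.+1 = (k.*2 - i.+1).+1 by lia.
  rewrite ltnS /=.
  have in_p w : 0 < w <= k.*2.+1 -> w \in p by rewrite (perm_mem pp) mem_iota.
  (* Distinct letters have distinct positions, so the absence of a descent is an ascent. *)
  case: ltngtP => // /index_inj eqi; exfalso.
  by apply: (@n_Sn (k.*2 - i.+1).+1); apply: (eqi 0); apply: in_p; lia.
Qed.

(** * The bijection through pairs of descent words *)

Lemma US312_build k p : reflect
  (exists d e, [/\ edom d e, rev_neg d \in dyck k & p = build d e])
  (p \in US k.*2.+1 [:: [:: 3; 1; 2]]).
Proof.
rewrite inE /= andbT; apply: (iffP and3P) => [[pp us /avoids312P av]|[d [e [dde]]]].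
  have up : uniq p by rewrite (perm_uniq pp) iota_uniq.
  have [d [e [szd dde defp]]] := avoids312_buildP pp av.
  exists d, e; split=> //; rewrite dyck_rev_neg szd eqxx /=.
  by move: us; rewrite avoids312_uniquely_sorted // defp des_build // andbC.
rewrite dyck_rev_neg => /and3P[/eqP szd eqd bd] ->.
have pp := perm_build dde; have av := avoids312_build dde.
split; [by rewrite -szd | | exact/avoids312P].
by rewrite avoids312_uniquely_sorted ?des_build ?bd // (perm_uniq pp) iota_uniq.
Qed.

Lemma DL_build k d e : edom d e -> size d = k.*2 ->
  DL k (build d e) = (rev_neg d, rev_neg e).
Proof.
move=> dde szd; rewrite DL_des_ides ?des_build ?ides_build // /is_perm_word -szd.
exact: perm_build.
Qed.

(** Two Dyck paths of semilength [k] have [k] letters [U] each, which gives the equality in [edom].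
    Conversely, a path above a Dyck path with as many letters [U] and the same length is itself a
    Dyck path. *)
Lemma stanley_intervals_rev_neg k d e :
  ((rev_neg d, rev_neg e) \in stanley_intervals k) = edom d e && (rev_neg d \in dyck k).
Proof.
rewrite inE /=; apply/and3P/andP => [[Dd De]|[dde Dd]].
  move: (Dd) (De); rewrite -![dyck _ _]/(_ \in dyck k) !dyck_rev_neg.
  case/and3P=> /eqP szd /eqP eqd bd /and3P[/eqP sze /eqP eqe _].
  rewrite stanley_le_rev_neg // => dde; rewrite szd eqd bd !eqxx; split=> //.
  rewrite /edom dde; apply/eqP.
  by have := nT_nF d; have := nT_nF e; lia.
have /andP[ded /eqP eqF] := dde; have szde := dom_size ded.
move: (Dd); rewrite dyck_rev_neg => /and3P[/eqP szd /eqP eqd bd].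
split=> //; last by rewrite stanley_le_rev_neg // -szde.
rewrite -[dyck _ _]/(_ \in dyck k) dyck_rev_neg -szde szd eqxx /=; apply/andP; split.
  by apply/eqP; have := nT_nF d; have := nT_nF e; lia.
apply/ballotP => j; have := domP szde ded j; have /ballotP/(_ j) := bd.
have := nT_nF (drop j d); have := nT_nF (drop j e); rewrite !size_drop szde; lia.
Qed.

Theorem theorem5p4 (k : nat) :
  [/\ {in US k.*2.+1 [:: [:: 3; 1; 2]],
        forall p : seq nat, DL k p \in stanley_intervals k},
      {in US k.*2.+1 [:: [:: 3; 1; 2]] &, injective (DL k)}
    & {in stanley_intervals k, forall xy : seq bool * seq bool,
        exists2 p : seq nat,
          p \in US k.*2.+1 [:: [:: 3; 1; 2]] & DL k p = xy}].
Proof.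
split=> [p|p q|[x y]].
- case/US312_build=> d [e [dde Dd ->]]; have := Dd; rewrite dyck_rev_neg => /andP[/eqP szd _].
  by rewrite DL_build // stanley_intervals_rev_neg dde.
- case/US312_build=> d [e [dde Dd ->]] /US312_build[d' [e' [dde' Dd' ->]]].
  move: Dd Dd'; rewrite !dyck_rev_neg => /andP[/eqP szd _] /andP[/eqP szd' _].
  by rewrite !DL_build // => -[/(can_inj rev_negK)-> /(can_inj rev_negK)->].
(* As [rev_neg] is an involution, any interval is the image of a pair of descent words, and [build]
   provides the preimage. *)
rewrite -{1}(rev_negK x) -{1}(rev_negK y) stanley_intervals_rev_neg => /andP[dde Dx].
exists (build (rev_neg x) (rev_neg y)).
  by apply/US312_build; exists (rev_neg x), (rev_neg y).
move: Dx; rewrite dyck_rev_neg => /andP[/eqP szx _].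
by rewrite DL_build // !rev_negK.
Qed.
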